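(* For every integer $n\geq 1$, the following identities hold (in $\mathbb{C}$, with $i$ the imaginary unit): (A) $C_A(n)=3^{3n-2}+\left(1+(-1)^n\right)\, i^n\, 3^{(3n-2)/2}$; (B) $C_B(n)=3^{3n-2}-\left(\left(1+(-1)^n\right)+i\sqrt{3}\left(1-(-1)^n\right)\right)\frac{i^n}{2}\,3^{(3n-2)/2}$; (C) $C_C(n)=3^{3n-2}-\left(\left(1+(-1)^n\right)-i\sqrt{3}\left(1-(-1)^n\right)\right)\frac{i^n}{2}\,3^{(3n-2)/2}$; (D) $C_D(n)=2\cdot 3^{3n-1}$.
   Context: For nonnegative integers $p_1,p_2,p_3$ with $P=p_1+p_2+p_3$, $\binom{P}{p_1,p_2,p_3}=\frac{P!}{p_1!\,p_2!\,p_3!}$ is the trinomial coefficient. All sums below run over triples $(k_1,k_2,k_3)$ of nonnegative integers with the indicated sum (an empty sum is $0$). Define $$C_A(n)=\sum_{k_1+k_2+k_3=n}\binom{3n}{3k_1,\,3k_2,\,3k_3}\quad (n\geq 0),$$ $$C_B(n)=\sum_{k_1+k_2+k_3=n-1}\binom{3n}{3k_1+1,\,3k_2+1,\,3k_3+1}\quad (n\geq 1),\qquad C_B(0)=0,$$ $$C_C(n)=\sum_{k_1+k_2+k_3=n-2}\binom{3n}{3k_1+2,\,3k_2+2,\,3k_3+2}\quad (n\geq 1),\qquad C_C(0)=0,$$ $$C_D(n)=6\sum_{k_1+k_2+k_3=n-1}\binom{3n}{3k_1,\,3k_2+1,\,3k_3+2}\quad (n\geq 1),\qquad C_D(0)=0.$$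 These count the words of $3n$ letters over a three-letter alphabet in which, respectively, all three letter multiplicities are $\equiv 0$ (A), all $\equiv 1$ (B), all $\equiv 2$ (C) modulo $3$, or the three multiplicities are congruent to $0,1,2$ modulo $3$ in some order (D). Half-integer powers of $3$ denote the positive real powers. *)

(* Defs.v *)
From mathcomp Require Import all_boot.

Set Implicit Arguments.
Unset Strict Implicit.
Unset Printing Implicit Defensive.

(* The upper index of the coefficient is implicit: it is p1 + p2 + p3.  The   *)
(* division is exact, see trinomial_fact.                                     *)
Definition trinomial (p1 p2 p3 : nat) : nat :=
  (p1 + p2 + p3)`! %/ (p1`! * p2`! * p3`!).

Lemma trinomial_fact (p1 p2 p3 : nat) :
  trinomial p1 p2 p3 * (p1`! * p2`! * p3`!) = (p1 + p2 + p3)`!.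
Proof.
have le1 : p1 <= p1 + p2 by rewrite leq_addr.
have le2 : p1 + p2 <= p1 + p2 + p3 by rewrite leq_addr.
rewrite /trinomial divnK // -(bin_fact le2) -(bin_fact le1) !addKn.
by rewrite dvdn_mull // dvdn_mul // dvdn_mull.
Qed.

(* The index bounds k_j <= n are implied by the constraint on the sum.  The   *)
(* constraint "sum = n - s" is written "sum + s = n", so that the range is    *)
(* empty when n < s instead of being affected by truncated subtraction; in    *)
(* particular C_B, C_C and C_D vanish at 0.                                   *)
Definition C_A (n : nat) : nat :=
  \sum_(k1 < n.+1) \sum_(k2 < n.+1) \sum_(k3 < n.+1 | k1 + k2 + k3 == n)
    trinomial (3 * k1) (3 * k2) (3 * k3).

Definition C_B (n : nat) : nat :=
  \sum_(k1 < n.+1) \sum_(k2 < n.+1) \sum_(k3 < n.+1 | k1 + k2 + k3 + 1 == n)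
    trinomial (3 * k1 + 1) (3 * k2 + 1) (3 * k3 + 1).

Definition C_C (n : nat) : nat :=
  \sum_(k1 < n.+1) \sum_(k2 < n.+1) \sum_(k3 < n.+1 | k1 + k2 + k3 + 2 == n)
    trinomial (3 * k1 + 2) (3 * k2 + 2) (3 * k3 + 2).

Definition C_D (n : nat) : nat :=
  6 * \sum_(k1 < n.+1) \sum_(k2 < n.+1) \sum_(k3 < n.+1 | k1 + k2 + k3 + 1 == n)
    trinomial (3 * k1) (3 * k2 + 1) (3 * k3 + 2).

(* Main.v *)
Require Import Defs.
From mathcomp Require Import all_boot all_order all_algebra.
From mathcomp Require Import reals exp.
From mathcomp Require Import complex.
From mathcomp Require Import zify ring.
Import GRing.Theory Num.Theory.

Local Open Scope ring_scope.
Local Open Scope complex_scope.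

(** The four counts are sums of the coefficients of (x + y + z)^(3n) over the
    monomials whose exponents have prescribed residues (a, b, c) modulo 3.  Such
    a sum S(a, b, c) is extracted by the roots-of-unity filter: if w is a
    primitive cube root of unity, substitute x = w^s, y = w^t, z = 1 and average
    w^(-sa - tb) (w^s + w^t + 1)^(3n) over s, t in {0, 1, 2}.  This selects the
    residues of the first two exponents; the third comes for free, because the
    exponents add up to a multiple of 3 ([residue_sum_filter]).

    The nine numbers w^s + w^t + 1 have very simple cubes.  One of them is 3 and
    two are 1 + w + w^2 = 0.  The other six are 2 + w and 2 + w^2 (twice each),
    1 + 2w and 1 + 2w^2; each is 1 + 2w = w - w^2 up to sign and a power of w.
    Since (w - w^2)^2 = -3, their cubes are v or -v, with v = 3 (w - w^2).
    Collecting the nine terms gives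
    ([residue_sum_closed])

      9 S(a, b, c) = 27^n + (w^(2a) + w^(2b) + w^(2c)) v^n
                          + (w^a + w^b + w^c) (-v)^n.

    With w = (-1 + i sqrt 3) / 2 one has v = 3 i sqrt 3, so v^n is i^n times
    (3 sqrt 3)^n = 3 * 3^((3n - 2) / 2).  The residues (0, 0, 0), (1, 1, 1),
    (2, 2, 2) make the two brackets equal to 3, 3, then 3w^2, 3w, then 3w, 3w^2;
    for (0, 1, 2) both brackets are 1 + w + w^2 = 0, which is why only the power
    of 3 survives in case (D). *)

(** * The trinomial theorem *)

Lemma trinomial_bin (a b c : nat) :
  trinomial a b c = ('C(a + b + c, a) * 'C(b + c, b))%N.
Proof.
have f0 : (0 < a`! * b`! * c`!)%N by rewrite !muln_gt0 !fact_gt0.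
apply/eqP; rewrite -(eqn_pmul2r f0) trinomial_fact; apply/eqP.
have := bin_fact (leq_addr (b + c) a); have := bin_fact (leq_addr c b).
rewrite !addKn addnA => <- <-; lia.
Qed.

(** The binomial theorem as a sum over the antidiagonal of a square of any side
    M > N.  A bound that does not depend on the exponent lets the theorem be
    iterated, and later lets the index range be a multiple of 3. *)
Lemma exprD_bounded (F : comNzRingType) (x y : F) (N M : nat) : (N < M)%N ->
  (x + y) ^+ N =
  \sum_(a < M) \sum_(b < M | (a + b == N)%N) 'C(N, a)%:R * x ^+ a * y ^+ b.
Proof.
move=> ltNM; rewrite addrC exprDn.
rewrite (big_ord_widen M (fun i => y ^+ (N - i) * x ^+ i *+ 'C(N, i)) ltNM).
rewrite big_mkcond /=.
apply: eq_bigr => a _; case: (leqP a N) => [leaN|ltNa]; last first.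
  by rewrite ltnS leqNgt ltNa /= big_pred0 // => b; lia.
have ltb : (N - a < M)%N by lia.
rewrite ltnS leaN (big_pred1 (Ordinal ltb)) /=; last first.
  by move=> b; rewrite /= -val_eqE /=; lia.
by rewrite -mulr_natl -mulrA [y ^+ _ * _]mulrC.
Qed.

(** Two applications of the binomial theorem, to x + (y + z) and to the powers
    of y + z; the intermediate exponent m is then eliminated, being forced to
    equal b + c. *)
Lemma expr_trinomial (F : comNzRingType) (x y z : F) (N M : nat) : (N < M)%N ->
  (x + y + z) ^+ N =
  \sum_(a < M) \sum_(b < M) \sum_(c < M | (a + b + c == N)%N)
    (trinomial a b c)%:R * (x ^+ a * y ^+ b * z ^+ c).
Proof.
move=> ltNM; rewrite -addrA (exprD_bounded _ _ _ _ _ ltNM); apply: eq_bigr => a _.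
pose G (m b c : nat) : F := 'C(N, a)%:R * x ^+ a * ('C(m, b)%:R * y ^+ b * z ^+ c).
transitivity (\sum_(m < M | (a + m == N)%N) \sum_(b < M)
                 \sum_(c < M | (b + c == m)%N) G m b c).
  apply: eq_bigr => m _; rewrite (exprD_bounded _ _ _ _ _ (ltn_ord m)) mulr_sumr.
  by apply: eq_bigr => b _; rewrite mulr_sumr.
rewrite exchange_big; apply: eq_bigr => b _ /=.
rewrite (exchange_big_dep xpredT) //= [RHS]big_mkcond; apply: eq_bigr => c _.
case: eqP => [def_N|neq_N]; last by rewrite big_pred0 // => m; lia.
have ltbc : (b + c < M)%N by lia.
rewrite (big_pred1 (Ordinal ltbc)) /=; last first.
  by move=> m; rewrite /= -val_eqE /=; lia.
by rewrite /G trinomial_bin def_N natrM; ring.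
Qed.

(** * Sums over prescribed residues modulo 3 *)

Lemma sum_residue3 (V : nmodType) (G : nat -> V) (n r : nat) : (r < 3)%N ->
  \sum_(k < 3 * n | (k %% 3 == r)%N) G k = \sum_(j < n) G (3 * j + r)%N.
Proof.
move=> ltr3; elim: n => [|n IHn]; first by rewrite muln0 !big_ord0.
rewrite big_ord_recr -IHn /= !(big_mkcond (fun k : 'I__ => _ == _)) /=.
rewrite mulnSr addn3 3!big_ord_recr /= -!addrA; congr (_ + _).
have -> : (3 * n %% 3 = 0)%N by lia.
have -> : ((3 * n).+1 %% 3 = 1)%N by lia.
have -> : ((3 * n).+2 %% 3 = 2)%N by lia.
case: r ltr3 {IHn} => [|[|[|]]] //= _; rewrite ?addr0 ?add0r;
  by rewrite ?addn0 ?addn1 ?addn2.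
Qed.

(** The sum of the coefficients of (x + y + z)^(3n) over the monomials whose
    exponents are congruent to a, b, c modulo 3, when a, b, c < 3. *)
Definition residue_sum (n a b c : nat) : nat :=
  \sum_(i < n.+1) \sum_(j < n.+1)
    \sum_(k < n.+1 | (3 * i + a + (3 * j + b) + (3 * k + c) == 3 * n)%N)
      trinomial (3 * i + a) (3 * j + b) (3 * k + c).

(** Dividing the constraint on the exponents by 3 gives the constraint
    i + j + k = n - d used for the four counts. *)
Lemma residue_sumE (n a b c d : nat) : (a + b + c = 3 * d)%N ->
  residue_sum n a b c =
  (\sum_(i < n.+1) \sum_(j < n.+1) \sum_(k < n.+1 | i + j + k + d == n)
      trinomial (3 * i + a) (3 * j + b) (3 * k + c))%N.
Proof.
move=> abc; apply: eq_bigr => i _; apply: eq_bigr => j _.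
by apply: eq_bigl => k; lia.
Qed.

Lemma C_A_residue (n : nat) : C_A n = residue_sum n 0 0 0.
Proof.
rewrite (residue_sumE _ _ _ _ 0) //; apply: eq_bigr => i _; apply: eq_bigr => j _.
by apply: eq_big => k; rewrite !addn0.
Qed.

Lemma C_B_residue (n : nat) : C_B n = residue_sum n 1 1 1.
Proof. by rewrite (residue_sumE _ _ _ _ 1). Qed.

Lemma C_C_residue (n : nat) : C_C n = residue_sum n 2 2 2.
Proof. by rewrite (residue_sumE _ _ _ _ 2). Qed.

Lemma C_D_residue (n : nat) : C_D n = (6 * residue_sum n 0 1 2)%N.
Proof.
rewrite (residue_sumE _ _ _ _ 1) //; congr (_ * _)%N.
apply: eq_bigr => i _; apply: eq_bigr => j _.
by apply: eq_bigr => k _; rewrite addn0.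
Qed.

(** * The roots-of-unity filter *)

Lemma cube_root_unity (F : comNzRingType) (w : F) :
  1 + w + w ^+ 2 = 0 -> w ^+ 3 = 1.
Proof.
move=> w0; apply/eqP; rewrite -subr_eq0; apply/eqP.
by transitivity ((w - 1) * (1 + w + w ^+ 2)); [ring | rewrite w0 mulr0].
Qed.

(** Orthogonality of the characters of Z/3: when 3 does not divide m, w^m is w
    or w^2 and the sum is 1 + w + w^2. *)
Lemma sum_cube_roots (F : comNzRingType) (w : F) (m : nat) :
  1 + w + w ^+ 2 = 0 -> \sum_(s < 3) w ^+ (s * m) = 3 * (3 %| m)%N%:R.
Proof.
move=> w0; have w3 := cube_root_unity _ _ w0.
under eq_bigr => s _ do rewrite mulnC exprM -(expr_mod m w3).
rewrite /dvdn 3!big_ord_recr big_ord0 /= add0r.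
have : (m %% 3 < 3)%N by rewrite ltn_pmod.
case: (m %% 3)%N => [|[|[|//]]] _ /=; rewrite ?mulr0 ?mulr1 ?expr0 ?expr1 //.
  by rewrite !expr1n; ring.
by rewrite -exprM (exprD w 3 1) w3 mul1r -w0; ring.
Qed.

(** The index k = 3j + r with j <= n runs over the residue class of r below
    3(n + 1); the values above 3n violate the constraint on the sum.  All three
    ranges then have the common bound required by [expr_trinomial]. *)
Lemma residue_sum_bounded (n a b c : nat) : (a < 3)%N -> (b < 3)%N -> (c < 3)%N ->
  residue_sum n a b c =
  (\sum_(i < 3 * n.+1 | i %% 3 == a) \sum_(j < 3 * n.+1 | j %% 3 == b)
    \sum_(k < 3 * n.+1 | k %% 3 == c)
      if i + j + k == 3 * n then trinomial i j k else 0)%N.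
Proof.
move=> lta ltb ltc; rewrite /residue_sum.
pose G i j k := (if i + j + k == 3 * n then trinomial i j k else 0)%N.
pose H i j := (\sum_(k < 3 * n.+1 | k %% 3 == c) G i j k)%N.
pose K i := (\sum_(j < 3 * n.+1 | j %% 3 == b) H i j)%N.
rewrite -[RHS]/(\sum_(i < 3 * n.+1 | i %% 3 == a) K i)%N.
rewrite (sum_residue3 _ K _ _ lta); apply: eq_bigr => i _.
rewrite /K (sum_residue3 _ (H _) _ _ ltb); apply: eq_bigr => j _.
by rewrite /H (sum_residue3 _ (G _ _) _ _ ltc) big_mkcond.
Qed.

(** After expanding the powers on the right, the sums over s and t factor for
    each monomial x^i y^j z^k and are evaluated by [sum_cube_roots]; writing
    w^(2a) for w^(-a) avoids inverses.  The surviving monomials satisfy i = a and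
    j = b modulo 3, and i + j + k = 3n then forces k = c. *)
Lemma residue_sum_filter (F : comNzRingType) (w : F) (n a b c : nat) :
    1 + w + w ^+ 2 = 0 -> (a < 3)%N -> (b < 3)%N -> (c < 3)%N ->
    (3 %| a + b + c)%N ->
  9 * (residue_sum n a b c)%:R =
  \sum_(s < 3) \sum_(t < 3)
     w ^+ (s * (2 * a)) * w ^+ (t * (2 * b)) * (w ^+ s + w ^+ t + 1) ^+ (3 * n).
Proof.
move=> w0 lta ltb ltc dvd3.
have ltM : (3 * n < 3 * n.+1)%N by lia.
pose X (s t i j k : nat) : F :=
  w ^+ (s * (2 * a + i)) * w ^+ (t * (2 * b + j)) * (trinomial i j k)%:R.
transitivity (\sum_(s < 3) \sum_(t < 3) \sum_(i < 3 * n.+1) \sum_(j < 3 * n.+1)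
    \sum_(k < 3 * n.+1 | (i + j + k == 3 * n)%N) X s t i j k); last first.
  apply: eq_bigr => s _; apply: eq_bigr => t _.
  rewrite (expr_trinomial _ _ _ _ _ _ ltM) mulr_sumr; apply: eq_bigr => i _.
  rewrite mulr_sumr; apply: eq_bigr => j _; rewrite mulr_sumr.
  apply: eq_bigr => k _; rewrite /X expr1n !mulnDr !exprD !exprM; ring.
under eq_bigr => s _ do rewrite exchange_big.
rewrite [RHS]exchange_big residue_sum_bounded // natr_sum mulr_sumr /= big_mkcond.
apply: eq_bigr => i _ /=.
under [RHS]eq_bigr => s _ do rewrite exchange_big.
rewrite [RHS]exchange_big /=.
transitivity (\sum_(j < 3 * n.+1) \sum_(k < 3 * n.+1 | (i + j + k == 3 * n)%N)
   (3 * (3 %| 2 * a + i)%N%:R) * (3 * (3 %| 2 * b + j)%N%:R)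
     * (trinomial i j k)%:R : F); last first.
  apply: eq_bigr => j _; under [RHS]eq_bigr => s _ do rewrite exchange_big.
  rewrite [RHS]exchange_big; apply: eq_bigr => k _ /=.
  rewrite -!(sum_cube_roots _ _ _ w0) mulr_suml mulr_suml.
  apply: eq_bigr => s _.
  by rewrite mulr_sumr mulr_suml.
case: ifP => [/eqP ia|ia]; last first.
  have -> : (3 %| 2 * a + i)%N = false by lia.
  by rewrite big1 // => j _; rewrite big1 // => k _; rewrite mulr0 !mul0r.
rewrite natr_sum mulr_sumr big_mkcond; apply: eq_bigr => j _ /=.
have -> : (3 %| 2 * a + i)%N by lia.
case: ifP => [/eqP jb|jb]; last first.
  have -> : (3 %| 2 * b + j)%N = false by lia.
  by rewrite big1 // => k _; rewrite !mulr0 mul0r.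
have -> : (3 %| 2 * b + j)%N by lia.
rewrite natr_sum mulr_sumr big_mkcond [RHS]big_mkcond; apply: eq_bigr => k _ /=.
case: (boolP (_ == 3 * n)%N) => [eN|]; last by case: ifP; rewrite ?mulr0.
have -> : (k %% 3 == c)%N by lia.
by ring.
Qed.

(** The hypothesis 0 < n kills the two terms with {s, t} = {1, 2}, where the
    base is 1 + w + w^2 = 0.  The symmetry in a, b, c, which the filter hides, is
    restored by w^(2a + 2b) = w^c and w^(a + b) = w^(2c). *)
Lemma residue_sum_closed (F : comNzRingType) (w : F) (n a b c : nat) :
    1 + w + w ^+ 2 = 0 -> (0 < n)%N -> (a < 3)%N -> (b < 3)%N -> (c < 3)%N ->
    (3 %| a + b + c)%N ->
  let v := 3 * (w - w ^+ 2) in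
  9 * (residue_sum n a b c)%:R =
  27 ^+ n + (w ^+ (2 * a) + w ^+ (2 * b) + w ^+ (2 * c)) * v ^+ n
    + (w ^+ a + w ^+ b + w ^+ c) * (- v) ^+ n.
Proof.
move=> w0 n0 lta ltb ltc dvd3 v; rewrite (residue_sum_filter _ _ _ _ _ _ w0) //.
have w3 := cube_root_unity _ _ w0.
have wsqr : w ^+ 2 = - 1 - w by rewrite -[LHS]subr0 -w0; ring.
have v_def : v = 3 + 6 * w by rewrite /v wsqr; ring.
have cubeE (x y : F) : x ^+ 3 = y -> x ^+ (3 * n) = y ^+ n.
  by move=> <-; rewrite exprM.
have E0 : 0 ^+ (3 * n) = 0 :> F by rewrite expr0n; case: (n) n0.
have E1 : (1 + 1 + 1) ^+ (3 * n) = 27 ^+ n :> F by apply: cubeE; ring.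
(* In E2 to E5, the cube of the base minus v or - v is a polynomial in w
   divisible by 1 + w + w ^ 2; the transitivity step gives the quotient. *)
have E2 : (2 + w) ^+ (3 * n) = v ^+ n.
  apply: cubeE; apply/eqP; rewrite -subr_eq0 v_def; apply/eqP.
  transitivity ((1 + w + w ^+ 2) * (w + 5)); first by ring.
  by rewrite w0 mul0r.
have E3 : (1 - w) ^+ (3 * n) = (- v) ^+ n.
  apply: cubeE; rewrite v_def; apply/eqP; rewrite -subr_eq0; apply/eqP.
  transitivity ((1 + w + w ^+ 2) * (4 - w)); first by ring.
  by rewrite w0 mul0r.
have E4 : (2 * w + 1) ^+ (3 * n) = (- v) ^+ n.
  apply: cubeE; rewrite v_def; apply/eqP; rewrite -subr_eq0; apply/eqP.
  transitivity ((1 + w + w ^+ 2) * (8 * w + 4)); first by ring.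
  by rewrite w0 mul0r.
have E5 : (- 1 - 2 * w) ^+ (3 * n) = v ^+ n.
  by rewrite -[v]opprK; apply: cubeE; rewrite v_def; apply/eqP;
    rewrite -subr_eq0; apply/eqP;
    transitivity (- (1 + w + w ^+ 2) * (8 * w + 4)); [ring | rewrite w0 oppr0 mul0r].
have wM (k l : nat) : (k = l %[mod 3])%N -> w ^+ k = w ^+ l.
  by move=> e; rewrite -(expr_mod k w3) e expr_mod.
rewrite 3!big_ord_recr big_ord0 3!big_ord_recr big_ord0.
rewrite 3!big_ord_recr big_ord0 3!big_ord_recr big_ord0 /=.
rewrite !mul0n !mul1n !expr0 !expr1 !mul1r !mulr1 !add0r -!exprD.
rewrite E1 wsqr.
(* The eight bases other than 3, reduced by w ^ 2 = -1 - w. *)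
have -> : 1 + w + 1 = 2 + w by ring.
have -> : w + 1 + 1 = 2 + w by ring.
have -> : 1 + (- 1 - w) + 1 = 1 - w by ring.
have -> : - 1 - w + 1 + 1 = 1 - w by ring.
have -> : w + w + 1 = 2 * w + 1 by ring.
have -> : w + (- 1 - w) + 1 = 0 by ring.
have -> : - 1 - w + w + 1 = 0 by ring.
have -> : - 1 - w + (- 1 - w) + 1 = - 1 - 2 * w by ring.
rewrite E0 E2 E3 E4 E5 !mulr0.
rewrite (wM (2 * (2 * a))%N a) ?(wM (2 * (2 * b))%N b); [|lia|lia].
rewrite (wM (2 * a + 2 * b)%N c) ?(wM (2 * (2 * a) + 2 * (2 * b))%N (2 * c)%N); [|lia|lia].
ring.
Qed.

(** * Evaluation in the complex numbers *)

Lemma powR_sqrt_cube (R : realType) (n : nat) :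
  3 * 3 `^ ((3 * n%:R - 2) / 2) = (3 * Num.sqrt 3) ^+ n :> R.
Proof.
have -> : 3 * Num.sqrt 3 = Num.sqrt 3 ^+ 3 :> R.
  by rewrite exprS sqr_sqrtr // mulrC.
rewrite -powR12_sqrt // -exprM -powR_mulrn ?powR_ge0 // -powRrM.
rewrite -[X in X * _]powRr1 // -powRD; last by rewrite pnatr_eq0 implybT.
by congr (_ `^ _); rewrite natrM; field.
Qed.

Theorem mainTheorem1 (R : realType) (n : nat) (hn : (1 <= n)%N) :
  [/\ (C_A n)%:R =
        3 ^+ (3 * n - 2)
        + (1 + (-1) ^+ n) * 'i%C ^+ n * (3 `^ ((3 * n%:R - 2) / 2))%:C :> R[i],
      (C_B n)%:R =
        3 ^+ (3 * n - 2)
        - ((1 + (-1) ^+ n) + 'i%C * (Num.sqrt 3)%:C * (1 - (-1) ^+ n))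
          * ('i%C ^+ n / 2) * (3 `^ ((3 * n%:R - 2) / 2))%:C :> R[i],
      (C_C n)%:R =
        3 ^+ (3 * n - 2)
        - ((1 + (-1) ^+ n) - 'i%C * (Num.sqrt 3)%:C * (1 - (-1) ^+ n))
          * ('i%C ^+ n / 2) * (3 `^ ((3 * n%:R - 2) / 2))%:C :> R[i]
    & (C_D n)%:R = 2 * 3 ^+ (3 * n - 1) :> R[i]].
Proof.
pose r : R[i] := (Num.sqrt 3)%:C; pose w : R[i] := ('i%C * r - 1) / 2.
pose p : R[i] := (3 `^ ((3 * n%:R - 2) / 2))%:C.
rewrite -/r -/p.
have r2 : r ^+ 2 = 3 by rewrite -rmorphXn sqr_sqrtr // rmorph_nat.
have i2 : 'i%C ^+ 2 = -1 :> R[i] by rewrite sqr_i.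
have w2 : w ^+ 2 = (- 'i%C * r - 1) / 2.
  rewrite /w expr_div_n sqrrB exprMn r2 i2 expr1n; by field.
have w0 : 1 + w + w ^+ 2 = 0 by rewrite w2 /w; by field.
have w3 := cube_root_unity _ _ w0.
have w4 : w ^+ 4 = w by rewrite exprS w3 mulr1.
have v_def : 3 * (w - w ^+ 2) = 'i%C * (3 * r) by rewrite w2 /w; by field.
have pE : (3 * r) ^+ n = 3 * p.
  have c3 : 3 = 3%:C :> R[i] by rewrite (rmorph_nat (real_complex R) 3).
  rewrite c3 -[_ * r]rmorphM -[_ * p]rmorphM -rmorphXn.
  by congr (_%:C); rewrite -powR_sqrt_cube.
have vn : ('i%C * (3 * r)) ^+ n = 'i%C ^+ n * (3 * p) by rewrite exprMn pE.
have q2 : 27 ^+ n = 9 * 3 ^+ (3 * n - 2) :> R[i].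
  have -> : 27 = 3 ^+ 3 :> R[i] by ring.
  have -> : 9 = 3 ^+ 2 :> R[i] by ring.
  by rewrite -exprM -exprD; congr (_ ^+ _); lia.
have q1 : 3 ^+ (3 * n - 1) = 3 * 3 ^+ (3 * n - 2) :> R[i].
  by rewrite -exprS; congr (_ ^+ _); lia.
have nine0 : 9 != 0 :> R[i] by rewrite pnatr_eq0.
have closed a b c := residue_sum_closed _ w n a b c w0 hn.
rewrite /= v_def q2 exprNn vn in closed.
have mul9I := mulfI nine0.
split; apply: mul9I.
- by rewrite C_A_residue closed // !muln0 !expr0; ring.
- rewrite C_B_residue closed // muln1 expr1 w2 /w; by field.
- rewrite C_C_residue closed // w4 w2 /w; by field.
rewrite C_D_residue natrM mulrCA closed // muln0 muln1 expr0 expr1 w4 q1.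
by rewrite w2 /w; field.
Qed.
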